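(* For any $\delta$, there is a bipartite graph $G$ of minimum degree $\delta$ and maximum degree $\exp^{\delta-1}(\delta)$ (so a tower of exponentials of height $\delta-1$) that is not $L$-colourable for some list assignment $L:V(G)\to 2^{\mathbb{Z}^+}$ satisfying \[ |L(u)|\ \ge\ \frac{\deg(u)}{\log\deg(u)} \] for all $u\in V(G)$.
   Context: Here $\exp^{i}$ denotes the $i$-fold iterate of the exponential function, so $\exp^{0}(\delta)=\delta$ and $\exp^{i+1}(\delta)=\exp(\exp^{i}(\delta))$; $\deg(u)$ is the degree of $u$ in $G$. A list assignment $L:V(G)\to 2^{\mathbb{Z}^+}$ gives each vertex a set of permissible colours, and $G$ is $L$-colourable if there is a proper colouring $c:V(G)\to\mathbb{Z}^+$ (adjacent vertices receive different colours) with $c(u)\in L(u)$ for all $u\in V(G)$.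
   Formalization: Stated for δ ≥ 3 only (for δ ≤ 1 the expressions are undefined; for δ = 2 the maximum degree e² is not an integer), and the maximum degree is the floor or ceiling (both are proved) of exp^{δ-1}(δ), which need not be an integer. *)

(* Defs.v *)
(* MathComp / MathComp-Analysis. *)
From HB Require Import structures.
From mathcomp Require Import all_boot all_order all_algebra.
From mathcomp Require Import all_classical all_reals all_analysis.

Set Implicit Arguments.
Unset Strict Implicit.
Unset Printing Implicit Defensive.

Import Order.TTheory GRing.Theory Num.Theory.

Local Open Scope classical_set_scope.
Local Open Scope ring_scope.

Definition simple_graph (V : finType) (adj : rel V) : Prop :=
  symmetric adj /\ irreflexive adj.

Definition bipartite (V : finType) (adj : rel V) : Prop :=
  exists A : {set V}, forall u v, adj u v -> (u \in A) != (v \in A).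

Definition degree (V : finType) (adj : rel V) (u : V) : nat := #|adj u|.

Definition min_degree_is (V : finType) (adj : rel V) (d : nat) : Prop :=
  (forall u, (d <= degree adj u)%N) /\ exists u, degree adj u = d.

Definition max_degree_is (V : finType) (adj : rel V) (d : nat) : Prop :=
  (forall u, (degree adj u <= d)%N) /\ exists u, degree adj u = d.

(* Colours are positive integers; lists may be infinite. *)
Definition list_assignment (V : finType) (L : V -> set nat) : Prop :=
  forall u, L u `<=` [set k | (0 < k)%N].

Definition list_colourable (V : finType) (adj : rel V) (L : V -> set nat) :
    Prop :=
  exists c : V -> nat,
    (forall u v, adj u v -> c u <> c v) /\ (forall u, L u (c u)).

Definition iter_exp (R : realType) (i : nat) (x : R) : R := iter i expR x.

(* [counting A] is the cardinality of [A] as an extended real, [+oo] when [A]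
   is infinite. *)
Definition list_size_ge (R : realType) (S : set nat) (x : R) : Prop :=
  (x%:E <= (counting S : \bar R))%E.

(* The tower [iter_exp i x] is in general not an integer; [is_rounding n x]
   holds exactly when [n] is the floor or the ceiling of [x]. *)
Definition is_rounding (R : realType) (n : nat) (x : R) : Prop :=
  `|n%:R - x| < 1.

(* Main.v *)
(* Call a bipartite list-graph a gadget if, however its inner vertices are
   coloured, some outer vertex sees its whole list. Take l copies of a gadget
   with N outer vertices and a new inner vertex, the root, joined to all lN outer
   vertices; the root has l colours, the i-th of which is added to the outer
   lists of the i-th copy. This is again a gadget, with outer lists longer by
   one. Since l >= lN / log (lN) as soon as lN >= e^N, each such level costs one
   exponential. For delta >= 4 lists of size delta - 1 suffice at the outer
   vertices, so delta - 1 levels do, which leaves room for rounding. For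
   delta = 3 three levels of this kind are slightly too expensive; the two lower
   ones are replaced by a gadget with only 6 outer vertices, obtained by letting
   the inner lists overlap and the outer vertices have degree 4. *)
Require Import Defs.
From HB Require Import structures.
From mathcomp Require Import finmap all_boot all_order all_algebra.
From mathcomp Require Import all_classical all_reals all_analysis.
From mathcomp Require Import ring lra zify.

Set Implicit Arguments.
Unset Printing Implicit Defensive.

Import Order.TTheory GRing.Theory Num.Theory.

Local Open Scope ring_scope.

(** * Gadgets and how to build them *)

Definition list_suffices (R : realType) (D l : nat) : Prop :=
  D%:R / ln (D%:R : R) <= l%:R.

(* [target a] is the degree that [a] has after padding, [M] being the largest
   one; the outer vertices have lists of size [k] and degree at most [d]. *)
Record gadget (R : realType) (delta M k d N : nat) := Gadget {
  inner : finType;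
  outer : finType;
  colour : finType;
  inc : inner -> outer -> bool;
  ilist : inner -> {set colour};
  olist : outer -> {set colour};
  target : inner -> nat;
  card_outer : #|outer| = N;
  card_olist : forall b, #|olist b| = k;
  deg_outer : forall b, (#|[pred a | inc a b]| <= d)%N;
  deg_inner : forall a, (#|inc a| <= target a)%N;
  target_bounds : forall a, (delta <= target a <= M)%N;
  target_list : forall a, list_suffices R (target a) #|ilist a|;
  target_min : exists a, target a = delta;
  target_max : exists a, target a = M;
  blocked : forall f : inner -> colour, (forall a, f a \in ilist a) ->
    exists b, forall x, x \in olist b -> exists2 a, inc a b & f a = x }.

Unset Strict Implicit.

(** The bottom level: whichever colour the only inner vertex takes, that colour is the entire list
    of one leaf. *)
Lemma gadget_star (R : realType) (delta : nat) : (0 < delta)%N ->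
  list_suffices R delta delta -> gadget R delta delta 1 1 delta.
Proof.
move=> delta_gt0 suff.
pose inc (_ : unit) (_ : 'I_delta) := true.
apply: (@Gadget R delta delta 1 1 delta unit 'I_delta 'I_delta inc
  (fun=> [set: 'I_delta]) (fun b => [set b]) (fun=> delta)).
- exact: card_ord.
- by move=> b; rewrite cards1.
- by move=> b; rewrite (leq_trans (max_card _))// card_unit.
- by move=> a; rewrite (leq_trans (max_card _))// card_ord.
- by move=> a; rewrite leqnn.
- by move=> a; rewrite cardsT card_ord.
- by exists tt.
- by exists tt.
- by move=> f _; exists (f tt) => x; rewrite inE => /eqP ->; exists tt.
Qed.

(* Inner vertices: a root choosing [i < 4], and for each [i] a vertex choosing
   some [j != i]; the outer vertex with list [{i, j}] is then blocked. *)
Lemma gadget_K4 (R : realType) :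
  list_suffices R 3 3 -> list_suffices R 6 4 -> gadget R 3 6 2 3 6.
Proof.
move=> s33 s64.
pose O := {b : {set 'I_4} | #|b| == 2}.
pose inc (a : option 'I_4) (b : O) := if a is Some i then i \in val b else true.
have cO : #|{: O}| = 6.
  by rewrite card_sig -[RHS]/('C(4, 2)) -[in RHS](card_ord 4) -card_draws cardsE.
apply: (@Gadget R 3 6 2 3 6 (option 'I_4) O 'I_4 inc
  (fun a => if a is Some i then ~: [set i] else [set: 'I_4])
  (fun b => val b) (fun a => if a is Some i then 3 else 6)).
- exact: cO.
- by move=> [b /= /eqP].
- move=> [b bP].
  rewrite (@leq_trans #|None |: [set Some i | i in b]|)//.
    apply/subset_leq_card/fintype.subsetP => -[i|]; rewrite !inE//= => ib.
    by apply/imsetP; exists i.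
  rewrite cardsU1 card_imset; last by move=> x y [].
  by rewrite (eqP bP) -[3%N]/(1 + 2)%N leq_add2r leq_b1.
- move=> [i|]; last by rewrite (leq_trans (max_card _))// cO.
  (* Removing [i] injects the pairs containing [i] into the singletons avoiding [i], of which there
     are 3. *)
  have <- : #|[set A : {set 'I_4} | A \subset ~: [set i] & #|A| == 1%N]| = 3.
    by rewrite cards_draws cardsC1 card_ord.
  pose h (b : O) := val b :\ i.
  have incE b : (b \in inc (Some i)) = (i \in val b) by [].
  have hinj : {in inc (Some i) &, injective h}.
    move=> b b'; rewrite !incE => ib ib' /(congr1 (finset.setU [set i])).
    by rewrite !finset.setD1K// => /val_inj.
  rewrite -(card_in_imset hinj); apply/subset_leq_card/fintype.subsetP => c.
  move=> /imsetP[b]; rewrite incE => ib ->; rewrite inE subsetDr /=.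
  by move: (valP b); rewrite (cardsD1 i) ib.
- by case.
- by case=> [i|]; rewrite ?cardsC1 ?cardsT card_ord.
- by exists (Some ord0).
- by exists None.
- move=> f fP; set i := f None; set j := f (Some i).
  have := fP (Some i); rewrite !inE -/j => ji.
  have bP : #|[set i; j]| == 2 by rewrite cards2 [i == j]eq_sym ji.
  exists (Sub [set i; j] bP : O) => x /=; rewrite !inE => /orP[] /eqP->.
    by exists None.
  by exists (Some i) => //=; rewrite !inE eqxx.
Qed.

(** The root itself has only [l * N] edges; allowing any larger target [D] lets the last root reach
    a prescribed maximum degree. *)
Lemma gadget_root (R : realType) (delta M k d N l D : nat) :
  gadget R delta M k d N -> (0 < l)%N -> (l * N <= D)%N ->
  (delta <= D)%N -> (M <= D)%N -> list_suffices R D l ->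
  gadget R delta D k.+1 d.+1 (l * N).
Proof.
move=> G l_gt0 lND dD MD suff.
pose A := option ('I_l * inner G)%type; pose B := ('I_l * outer G)%type.
pose C := (colour G + 'I_l)%type.
pose incs (a : A) (b : B) :=
  if a is Some (i, a) then (i == b.1) && inc G a b.2 else true.
have inl_inj : injective (inl : colour G -> C) by move=> x y [].
have inr_inj : injective (inr : 'I_l -> C) by move=> x y [].
have cB : #|{: B}| = (l * N)%N.
  by rewrite card_prod card_ord (card_outer G).
apply: (@Gadget R delta D k.+1 d.+1 (l * N) A B C incs
  (fun a => if a is Some (i, a) then inl @: ilist G a else inr @: [set: 'I_l])
  (fun b => inr b.1 |: inl @: olist G b.2)
  (fun a => if a is Some (i, a) then target G a else D)).
- exact: cB.
- move=> [i b]; rewrite cardsU1 card_imset// (card_olist G) /=.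
  suff -> : inr i \notin [set inl x | x in olist G b] by [].
  by apply/imsetP => -[].
- move=> [i b].
  rewrite (@leq_trans #|None |: [set Some (i, a) | a in [pred a | inc G a b]]|)//.
    apply/subset_leq_card/fintype.subsetP => -[[j a]|]; rewrite !inE//=.
    by move=> /andP[/eqP-> ab]; apply/imsetP; exists a.
  rewrite cardsU1 card_imset; last by move=> x y [].
  rewrite -add1n leq_add ?leq_b1//; exact: (deg_outer G).
- move=> [[i a]|]; last by rewrite (leq_trans (max_card _))// cB.
  rewrite (leq_trans _ (deg_inner G a))//.
  rewrite -(card_imset (inc G a) (_ : injective (pair i))); last by move=> x y [].
  apply/subset_leq_card/fintype.subsetP => -[j b]; rewrite unfold_in /= => /andP[/eqP<- ab].
  by apply/imsetP; exists b.
- move=> [[i a]|]; last by rewrite dD leqnn.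
  have /andP[-> /=] := target_bounds G a.
  by move/leq_trans; apply.
- move=> [[i a]|].
    by rewrite card_imset//; exact: (target_list G).
  by rewrite card_imset// cardsT card_ord.
- have [a aD] := target_min G.
  by exists (Some (Ordinal l_gt0, a)).
- by exists None.
(* The root's colour [i] selects the [i]-th copy. The outer vertex blocked there sees its old list
   inside the copy and the added colour at the root. *)
- move=> f fP.
  have /imsetP[i _ fi] := fP None.
  have /choice[g gP] : forall a, exists x, x \in ilist G a /\ f (Some (i, a)) = inl x.
    by move=> a; have /imsetP[x xa ->] := fP (Some (i, a)); exists x.
  have [b bP] := blocked G g (fun a => (gP a).1).
  exists (i, b) => x; rewrite !inE => /orP[/eqP->|/imsetP[y yb ->]].
    by exists None.
  have [a ab <-] := bP y yb.
  by exists (Some (i, a)); rewrite /= ?eqxx ?(gP a).2.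
Qed.

(** * From gadgets to list-graphs with prescribed degrees *)

Lemma list_size_ge_pickle (R : realType) (C : finType) (A : {set C}) (x : R) :
  x <= #|A|%:R ->
  list_size_ge [set n | exists2 y, y \in A & n = (pickle y).+1]%classic x.
Proof.
move=> xA; rewrite /list_size_ge.
set s := [seq (pickle y).+1 | y <- enum A].
have -> : [set n | exists2 y, y \in A & n = (pickle y).+1]%classic =
    [set` finmap.seq_fset tt s]%classic.
  apply/seteqP; split => [_ [y yA ->]|n].
    have : (pickle y).+1 \in s by apply/map_f; rewrite mem_enum.
    by rewrite -(finmap.seq_fsetE tt).
  move=> nS; have : n \in finmap.seq_fset tt s by [].
  by rewrite finmap.seq_fsetE => /mapP[y]; rewrite mem_enum => yA ->; exists y.
rewrite /counting asboolT; last exact: finite_fset.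
rewrite set_fsetK finmap.size_seq_fset undup_id ?size_map -?cardE ?lee_fin//.
rewrite map_inj_uniq ?enum_uniq// => u v [].
exact: (pcan_inj pickleK).
Qed.

(** Serves the padding vertices: their list is infinite, so it meets every size bound. *)
Lemma list_size_ge_positive (R : realType) (x : R) :
  list_size_ge [set n | (0 < n)%N]%classic x.
Proof.
rewrite /list_size_ge /counting asboolF ?leey// => fin.
apply: infinite_nat.
have -> : [set: nat]%classic = ([set 0%N] `|` [set n | (0 < n)%N])%classic.
  by apply/seteqP; split=> // -[|n] _; [left|right].
by rewrite finite_setU; split => //; exact: finite_set1.
Qed.

(* Take [delta] disjoint copies of the graph; a vertex [v] that lacks [m] edges
   gets [m] new vertices, each adjacent to the [delta] copies of [v]. *)
Lemma pad_degrees (R : realType) (V C : finType) (e : rel V) (side : pred V)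
    (L : V -> {set C}) (D : V -> nat) (delta M : nat) :
  (0 < delta)%N -> symmetric e -> (forall u v, e u v -> side u != side v) ->
  (forall v, #|e v| <= D v)%N -> (forall v, delta <= D v <= M)%N ->
  (exists v, D v = delta) -> (exists v, D v = M) ->
  (forall v, list_suffices R (D v) #|L v|) ->
  (forall c : V -> C, (forall v, c v \in L v) ->
    exists u v, e u v /\ c u = c v) ->
  exists (W : finType) (adj : rel W),
    [/\ simple_graph adj,
        bipartite adj,
        min_degree_is adj delta,
        max_degree_is adj M
      & exists L : W -> set nat,
          [/\ list_assignment L,
              forall u : W,
                list_size_ge (L u)
                  ((degree adj u)%:R / ln ((degree adj u)%:R : R))
            & ~ list_colourable adj L]].
Proof.
move=> delta_gt0 esym eside eD Dbnd [v0 Dv0] [v1 Dv1] Lsuff nocol.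
pose P := {v : V & 'I_(D v - #|e v|)}.
pose W := ('I_delta * V + P)%type.
pose adj : rel W := fun x y => match x, y with
  | inl (i, u), inl (j, v) => (j == i) && e u v
  | inl (i, u), inr p => tag p == u
  | inr p, inl (j, v) => v == tag p
  | inr _, inr _ => false end.
have degl i v : degree adj (inl (i, v)) = D v.
  rewrite /degree -sum1_card big_sumType /= !sum1_card.
  rewrite (@eq_card _ _ [predX pred1 i & e v]); last by move=> [j w]; rewrite !inE.
  rewrite cardX card1 mul1n.
  rewrite (@eq_card _ _ [set Tagged (fun v => 'I_(D v - #|e v|)) t | t : 'I_(D v - #|e v|)]).
    rewrite card_imset ?card_ord ?subnKC// => s t /eqP.
    by rewrite eq_Tagged => /eqP.
  move=> [w t]; rewrite [LHS]unfold_in /=; apply/eqP/imsetP => [wv|[s _ /(congr1 tag)]//].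
  by subst w; exists t.
(* With exactly [delta] copies, the new vertices have the minimum degree and disturb neither degree
   bound. *)
have degr p : degree adj (inr p) = delta.
  rewrite /degree -sum1_card big_sumType /= !sum1_card.
  rewrite (@eq_card _ _ [predX 'I_delta & pred1 (tag p)]); last first.
    by move=> [j w]; rewrite !inE.
  by rewrite cardX card1 card_ord muln1 eq_card0 ?addn0.
pose i0 := Ordinal delta_gt0.
have deltaM : (delta <= M)%N by have /andP[/leq_trans] := Dbnd v0; apply.
exists W, adj; split.
- split.
    move=> [[i u]|p] [[j v]|q]//=.
    by rewrite eq_sym esym.
  move=> [[i u]|p]//=; rewrite eqxx /=.
  by apply/negP => /eside; rewrite eqxx.
(* A padding vertex goes on the side opposite to the vertex it serves. *)
- exists [set x : W | match x with inl (_, v) => side v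
                      | inr p => ~~ side (tag p) end].
  move=> [[i u]|p] [[j v]|q]; rewrite !inE //=.
  + by move=> /andP[_ /eside].
  + by move=> /eqP->; case: (side u).
  + by move=> /eqP->; case: (side _).
- split; last by exists (inl (i0, v0)); rewrite degl.
  by move=> [[i v]|p]; rewrite ?degl ?degr//; have /andP[] := Dbnd v.
- split; last by exists (inl (i0, v1)); rewrite degl.
  by move=> [[i v]|p]; rewrite ?degl ?degr//; have /andP[] := Dbnd v.
- exists (fun x : W => match x with
    | inl (_, v) => [set n | exists2 y, y \in L v & n = (pickle y).+1]
    | inr _ => [set n | (0 < n)%N] end%classic); split.
  + by move=> [[i v]|p] n //= [y _ ->].
  + move=> [[i v]|p]; last exact: list_size_ge_positive.
    by apply: list_size_ge_pickle; rewrite degl; exact: Lsuff.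
  + move=> [c [cproper cL]].
    (* One copy already gives a contradiction: undoing the shifted [pickle] there yields a choice
       from the lists [L], which [nocol] forbids to be proper. *)
    have /choice[g gP] : forall v, exists y,
        y \in L v /\ c (inl (i0, v)) = (pickle y).+1.
      by move=> v; have [y yL ->] := cL (inl (i0, v)); exists y.
    have [u [v [uv guv]]] := nocol g (fun v => (gP v).1).
    apply: (cproper (inl (i0, u)) (inl (i0, v))); first by rewrite /adj eqxx.
    by rewrite (gP u).2 (gP v).2 guv.
Qed.

Lemma gadget_graph (R : realType) (delta M k d N D : nat) :
  gadget R delta M k d N -> (0 < delta)%N -> (d <= D)%N -> (delta <= D <= M)%N ->
  list_suffices R D k ->
  exists (V : finType) (adj : rel V),
    [/\ simple_graph adj,
        bipartite adj,
        min_degree_is adj delta,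
        max_degree_is adj M
      & exists L : V -> set nat,
          [/\ list_assignment L,
              forall u : V,
                list_size_ge (L u)
                  ((degree adj u)%:R / ln ((degree adj u)%:R : R))
            & ~ list_colourable adj L]].
Proof.
move=> G delta_gt0 dD Dbnd suff.
pose V := (inner G + outer G)%type.
pose e : rel V := fun x y => match x, y with
  | inl a, inr b | inr b, inl a => inc G a b
  | _, _ => false end.
apply: (@pad_degrees R V (colour G) e
  (fun x => if x is inl _ then true else false)
  (fun x => match x with inl a => ilist G a | inr b => olist G b end)
  (fun x => match x with inl a => target G a | inr b => D end)).
- exact: delta_gt0.
- by move=> [a|b] [a'|b'].
- by move=> [a|b] [a'|b'].
- move=> [a|b]; rewrite -sum1_card big_sumType /= !sum1_card.
    rewrite eq_card0 ?add0n//; exact: (deg_inner G).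
  rewrite [X in (_ + X)%N]eq_card0 ?addn0//.
  exact: leq_trans (deg_outer G b) dD.
- by move=> [a|b] //; exact: (target_bounds G).
- by have [a aD] := target_min G; exists (inl a).
- by have [a aM] := target_max G; exists (inl a).
- move=> [a|b]; first exact: (target_list G).
  by rewrite (card_olist G).
- move=> c cL.
  (* The colour of the blocked vertex [b] lies in its own list, so some neighbour has it too. *)
  have [b bP] := blocked G (c \o inl) (fun a => cL (inl a)).
  have [a ab ca] := bP _ (cL (inr b)).
  by exists (inl a), (inr b).
Qed.

(** * Numerical estimates *)

Lemma list_suffices_le (R : realType) (D l : nat) (x : R) :
  0 < x -> expR x <= D%:R -> D%:R <= l%:R * x -> list_suffices R D l.
Proof.
move=> x_gt0 xD Dl; rewrite /list_suffices.
have D_gt0 : 0 < D%:R :> R := lt_le_trans (expR_gt0 x) xD.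
have xln : x <= ln D%:R by rewrite -[x]expRK ler_ln ?posrE ?expR_gt0.
rewrite ler_pdivrMr ?(lt_le_trans x_gt0)//.
by rewrite (le_trans Dl)// ler_wpM2l.
Qed.

(** Since (1 - x/n)^n <= exp(-x), an upper bound on exp(x) reduces to rational arithmetic. *)
Lemma expR_le_of_pow (R : realType) (n : nat) (x c : R) :
  (0 < n)%N -> x < n%:R -> 1 <= c * (1 - x / n%:R) ^+ n -> expR x <= c.
Proof.
move=> n_gt0 xn cn; have n0 : 0 < n%:R :> R by rewrite ltr0n.
have lt1 : 0 <= 1 - x / n%:R by rewrite subr_ge0 ler_pdivrMr ?mul1r ?ltW.
have c_ge0 : 0 <= c.
  rewrite leNgt; apply/negP => c_lt0; have := exprn_ge0 n lt1; nra.
have : (1 - x / n%:R) ^+ n <= expR (- x).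
  rewrite (_ : - x = n%:R * - (x / n%:R)); last by field; rewrite gt_eqF.
  by rewrite expRM_natl lerXn2r ?nnegrE ?expR_ge0// expR_ge1Dx.
move=> /(ler_wpM2l c_ge0)/(le_trans cn).
by rewrite expRN ler_pdivlMr ?expR_gt0// mul1r.
Qed.

Lemma expR1_le3 (R : realType) : expR 1 <= 3 :> R.
Proof. by apply: (@expR_le_of_pow R 6) => //; lra. Qed.

Lemma list_suffices64 (R : realType) : list_suffices R 6 4.
Proof.
(* The value 3/2 is the least x with 6 <= 4x. *)
apply: (@list_suffices_le R _ _ (3 / 2)); try lra.
by apply: (@expR_le_of_pow R 5) => //; lra.
Qed.

Lemma list_suffices_diag (R : realType) (delta : nat) :
  (3 <= delta)%N -> list_suffices R delta delta.
Proof.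
move=> d3; apply: (@list_suffices_le R _ _ 1); rewrite ?mulr1//.
by apply: le_trans (expR1_le3 R) _; rewrite ler_nat.
Qed.

Lemma list_suffices_pred (R : realType) (delta : nat) :
  (4 <= delta)%N -> list_suffices R delta delta.-1.
Proof.
move=> d4; have d4' : 4 <= delta%:R :> R by rewrite ler_nat.
(* The inequality [delta] <= (4/3)([delta] - 1) holds exactly from 4 on, and exp(4/3) <= 4 is the
   square of exp(2/3) <= 2. *)
apply: (@list_suffices_le R _ _ (4 / 3)); first by lra.
  have e2 : expR (2 / 3) <= 2 :> R by apply: (@expR_le_of_pow R 10) => //; lra.
  have e0 := expR_gt0 (2 / 3 : R).
  rewrite [4 / 3](_ : _ = 2 / 3 + 2 / 3); last by lra.
  rewrite expRD; nra.
have -> : delta.-1%:R = delta%:R - 1 :> R by rewrite -subn1 natrB//; lia.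
lra.
Qed.

(** Carries a slack of 2 through one level of the tower, where [N] grows to at most exp(N) + N. *)
Lemma expR_ge2D (R : realType) (x : R) : 0 <= x -> expR x + x + 2 <= expR (x + 2).
Proof.
move=> x0; have hx := expR_ge1Dx x.
have e2 : 3 <= expR 2 :> R by have := expR_ge1Dx (2 : R); lra.
rewrite expRD; have := ler_wpM2l (expR_ge0 x) e2; lra.
Qed.

(** * Climbing the tower *)

Lemma gadget_tower (R : realType) (delta j : nat) : (3 <= delta)%N ->
  exists N, [/\ (delta <= N)%N,
    N%:R + 2 <= iter j.+1 (@expR R) delta%:R &
    inhabited (gadget R delta N j.+1 j.+1 N)].
Proof.
move=> d3; have d3' : 3 <= delta%:R :> R by rewrite ler_nat.
have d_gt0 : (0 < delta)%N by lia.
elim: j => [|j [N [dN Ntower [G]]]].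
  exists delta; split => //=.
    have := expR_ge1Dxn 1 (le_trans (ler0n _ 3) d3').
    rewrite !factS fact0 /=; nra.
  constructor; apply: gadget_star => //; exact: list_suffices_diag.
have N_gt0 : 0 < N%:R :> R by rewrite ltr0n; lia.
(* This [l] exceeds exp(N)/N by at most 1: thus [l * N] > exp(N), so the root's list is long enough,
   while [l * N] <= exp(N) + N. *)
pose l := (Num.truncn (expR N%:R / N%:R : R)).+1.
have /andP[llo lhi] := truncn_itv (divr_ge0 (expR_ge0 (N%:R : R)) (ltW N_gt0)).
rewrite ler_pdivlMr// in llo; rewrite ltr_pdivrMr// -/l in lhi.
have lS : l%:R = (Num.truncn (expR N%:R / N%:R : R))%:R + 1 :> R by rewrite -natr1.
have NlN : (N <= l * N)%N by rewrite leq_pmull.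
exists (l * N)%N; split; first exact: leq_trans NlN.
  have := expR_ge2D (ltW N_gt0); move: Ntower; rewrite -ler_expR -iterS.
  by rewrite natrM lS; lra.
constructor; apply: gadget_root G _ _ _ _ _ => //; first exact: leq_trans NlN.
apply: (@list_suffices_le R _ _ N%:R) => //; rewrite natrM//; exact: ltW.
Qed.

(** Takes [Delta %/ N] copies under a root of target exactly [Delta]. One unit of the slack 2
    absorbs the rounding of the tower and leaves log(Delta) >= N + 1; the other pays for the
    remainder of the division. *)
Lemma gadget_top (R : realType) (delta M k d N Delta : nat) (y : R) :
  gadget R delta M k d N -> (0 < N)%N -> (M <= N)%N -> (delta <= N)%N ->
  N%:R + 2 <= y -> expR y - 1 < Delta%:R ->
  (N <= Delta)%N /\ exists n, inhabited (gadget R delta Delta k.+1 d.+1 n).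
Proof.
move=> G N0 MN dN Ny yD.
have N_gt0 : 1 <= N%:R :> R by rewrite ler1n.
have e1 : 2 <= expR 1 :> R by have := expR_ge1Dx (1 : R); lra.
have Delta_exp : expR (N%:R + 2) - 1 < Delta%:R :> R.
  by apply: (le_lt_trans _ yD); rewrite lerB// ler_expR.
have DeltaE : expR (N%:R + 1) <= Delta%:R :> R.
  rewrite (_ : N%:R + 2 = N%:R + 1 + 1) in Delta_exp; last by ring.
  rewrite expRD in Delta_exp; have := expR_ge1Dx (N%:R + 1 : R); nra.
have DeltaN : (N * N <= Delta)%N.
  rewrite -(ler_nat R) natrM.
  (* The splitting gives exp(N + 2) >= 4 (1 + N/2)^2 = (N + 2)^2, hence [Delta] >= N^2. *)
  rewrite (_ : N%:R + 2 = N%:R / 2 + N%:R / 2 + 1 + 1) in Delta_exp; last by field.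
  rewrite !expRD in Delta_exp; have h := expR_ge1Dx (N%:R / 2 : R).
  have h2 : (1 + N%:R / 2) * (1 + N%:R / 2) <= expR (N%:R / 2) * expR (N%:R / 2 : R).
    by apply: ler_pM => //; lra.
  have e2 : 2 * 2 <= expR 1 * expR 1 :> R by apply: ler_pM => //; lra.
  have : (1 + N%:R / 2) * (1 + N%:R / 2) * (2 * 2) <=
      expR (N%:R / 2) * expR (N%:R / 2) * (expR 1 * expR 1) :> R.
    by apply: ler_pM => //; nra.
  rewrite [X in _ <= X]mulrA; lra.
have NDelta : (N <= Delta)%N by nia.
split => //; exists (Delta %/ N * N)%N; constructor.
have NlN : (N <= Delta %/ N)%N by rewrite leq_divRL.
apply: gadget_root G _ _ _ _ _.
- exact: leq_trans NlN.
- exact: leq_divM.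
- exact: leq_trans NDelta.
- exact: leq_trans NDelta.
- apply: (@list_suffices_le R _ _ (N%:R + 1)) => //.
  (* The remainder is below [N], which is at most the quotient l, so [Delta] <= l N + l. *)
  rewrite natr1 -natrM ler_nat mulnS {1}(divn_eq Delta N) addnC leq_add2r.
  by apply: leq_trans NlN; rewrite ltnW// ltn_pmod.
Qed.

Theorem proposition11 (R : realType) (delta : nat) (hdelta : (3 <= delta)%N)
    (Delta : nat) (hDelta : is_rounding Delta (iter_exp delta.-1 (delta%:R : R))) :
  exists (V : finType) (adj : rel V),
    [/\ simple_graph adj,
        bipartite adj,
        min_degree_is adj delta,
        max_degree_is adj Delta
      & exists L : V -> set nat,
          [/\ list_assignment L,
              forall u : V,
                list_size_ge (L u)
                  ((degree adj u)%:R / ln ((degree adj u)%:R : R))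
            & ~ list_colourable adj L]].
Proof.
have Delta_gt : expR (iter delta.-2 (@expR R) delta%:R) - 1 < Delta%:R :> R.
  move: hDelta; rewrite /is_rounding /iter_exp ltr_norml => /andP[+ _].
  by case: delta hdelta => [|[|d]]//= _; lra.
case: (leqP 4 delta) => [d4 | d_lt4].
(* Here [delta] - 2 levels come from the tower and one from the top, so outer lists have size
   [delta] - 1 and outer degrees can be padded to [delta]. *)
- have [N [dN Ntower [G]]] := @gadget_tower R delta (delta - 3) hdelta.
  have dE : (delta - 3).+1 = delta.-2 by lia.
  rewrite dE in Ntower G.
  have N_gt0 : (0 < N)%N by lia.
  have [NDelta [n [G']]] := gadget_top G N_gt0 (leqnn _) dN Ntower Delta_gt.
  apply: (@gadget_graph _ _ _ _ _ _ delta G'); rewrite ?leqnn ?(leq_trans dN)//; try lia.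
  rewrite (_ : delta.-2.+1 = delta.-1); last by lia.
  exact: list_suffices_pred.
- have {hdelta d_lt4} d3 : delta = 3%N by lia.
  subst delta; rewrite /= in Delta_gt.
  have G := gadget_K4 (list_suffices_diag R (leqnn 3)) (list_suffices64 R).
  have e3 : 6%:R + 2 <= expR 3%:R :> R.
    have e1 : 2 <= expR 1 :> R by have := expR_ge1Dx (1 : R); lra.
    rewrite -[3%:R]mulr1 expRM_natl.
    have := lerXn2r 3 (ler0n R 2) (expR_ge0 (1 : R)) e1; lra.
  have [NDelta [n [G']]] := gadget_top G isT isT isT e3 Delta_gt.
  (* Outer vertices now have lists of size 3 and are padded to degree 4; the minimum degree 3 is
     attained at inner vertices. *)
  apply: (@gadget_graph _ _ _ _ _ _ 4 G') => //; first lia.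
  exact: (@list_suffices_pred R 4).
Qed.
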